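(* Let $R$ be a commutative ring with unit, let $A$ and $B$ be Frobenius $R$-algebras, and let $\phi:A\twoheadrightarrow B$ be a surjective homomorphism of algebras, with Schur element $s_\phi\in B$. The following conditions are equivalent: 1. $s_\phi$ is invertible in $B$. 2. $\phi:A\twoheadrightarrow B$ splits as a morphism of right $A$-modules. 3. $B$ is a projective right $A$-module. 4. Every projective (right) $B$-module is a projective right $A$-module.
   Context: An associative unital $R$-algebra $A$ is Frobenius if it is finitely generated and projective as an $R$-module and is equipped with an isomorphism of left $A$-modules $\lambda_l:A\to A^*=\mathrm{Hom}_R(A,R)$, where $A^*$ has the left action $(a\cdot f)(b)=f(ba)$. Its trace is $\varepsilon_A=\lambda_l(1_A):A\to R$. Right $B$-modules (in particular $B$ itself) are right $A$-modules via $\phi$: $x\cdot a=x\phi(a)$. Schur element: for Frobenius algebras $(A,\varepsilon_A)$, $(B,\varepsilon_B)$ and a surjective algebra homomorphism $\phi:A\to B$, the functional $\varepsilon_B\circ\phi$ lies in $A^*$, so there is a unique $u\in A$ with $u\cdot\varepsilon_A=\varepsilon_B\circ\phi$; the Schur element of $\phi$ is $s_\phi=\phi(u)\in B$. *)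

(* Defs.v *)
From HB Require Import structures.
From mathcomp Require Import all_boot all_algebra.
From mathcomp Require Import boolp.
Set Implicit Arguments.
Unset Strict Implicit.
Unset Printing Implicit Defensive.

Import GRing.Theory.
Local Open Scope ring_scope.

Definition surjective (T U : Type) (f : T -> U) : Prop :=
  forall y, exists x, f x = y.

Definition invertible (S : pzRingType) (x : S) : Prop :=
  exists y, x * y = 1 /\ y * x = 1.

Definition finitely_generated (S : pzRingType) (M : lmodType S) : Prop :=
  exists (n : nat) (v : 'I_n -> M),
    forall x : M, exists c : 'I_n -> S, x = \sum_(i < n) c i *: v i.

Definition projective (S : pzRingType) (M : lmodType S) : Prop :=
  forall (N N' : lmodType S) (g : {linear N -> N'}) (f : {linear M -> N'}),
    surjective g -> exists h : {linear M -> N}, forall x, g (h x) = f x.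

(* Restriction of scalars along a ring morphism. *)
Definition pullback (S T : pzRingType) (f : {rmorphism S -> T})
  (M : lmodType T) : Type := M.

Section Pullback.
Variables (S T : pzRingType) (f : {rmorphism S -> T}) (M : lmodType T).

HB.instance Definition _ := GRing.Zmodule.on (pullback f M).

Definition pullback_scale (a : S) (x : pullback f M) : pullback f M :=
  f a *: (x : M).

Fact pullback_scaleA a b x :
  pullback_scale a (pullback_scale b x) = pullback_scale (a * b) x.
Proof. by rewrite /pullback_scale scalerA rmorphM. Qed.

Fact pullback_scale1 : left_id 1 pullback_scale.
Proof. by move=> x; rewrite /pullback_scale rmorph1 scale1r. Qed.

Fact pullback_scaleDr : right_distributive pullback_scale +%R.
Proof. by move=> a x y; rewrite /pullback_scale scalerDr. Qed.

Fact pullback_scaleDl x : {morph pullback_scale^~ x : a b / a + b}.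
Proof. by move=> a b; rewrite /pullback_scale rmorphD scalerDl. Qed.

HB.instance Definition _ := GRing.Zmodule_isLmodule.Build S (pullback f M)
  pullback_scaleA pullback_scale1 pullback_scaleDr pullback_scaleDl.

End Pullback.

(* A right S-module is a left module over the converse ring [S^c]: the right
   action x . a is [(a : S^c) *: x].  In particular [S^c^o] is S as a right
   module over itself. *)
Notation rmodType S := (lmodType S^c).

Section ConverseMorphism.
Variables (S T : pzRingType) (f : {rmorphism S -> T}).

Definition converse_hom (a : S^c) : T^c := f a.

Fact converse_hom_is_zmod_morphism : zmod_morphism converse_hom.
Proof. exact: (rmorphB f). Qed.

Fact converse_hom_is_monoid_morphism : monoid_morphism converse_hom.
Proof. by split; [exact: (rmorph1 f) | move=> a b; exact: (rmorphM f)]. Qed.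

HB.instance Definition _ :=
  GRing.isZmodMorphism.Build S^c T^c converse_hom converse_hom_is_zmod_morphism.
HB.instance Definition _ :=
  GRing.isMonoidMorphism.Build S^c T^c converse_hom
    converse_hom_is_monoid_morphism.

(* The right S-module with x . a = x f(a). *)
Definition rpullback (M : rmodType T) : rmodType S := pullback converse_hom M.

End ConverseMorphism.

(* The library's [algType] requires 1 != 0, which would exclude the zero
   algebra, e.g. as the target of a surjection.  An associative unital algebra
   is given here by a ring and a ring morphism from R to its center. *)
Record algebra (R : comPzRingType) := Algebra {
  alg_ring :> pzRingType;
  alg_map : {rmorphism R -> alg_ring};
  alg_central : forall (k : R) (x : alg_ring), alg_map k * x = x * alg_map k
}.

Definition algebra_of_algType (R : comNzRingType) (A : algType R) : algebra R :=
  @Algebra R A (in_alg A)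
    (fun k x => etrans (mulr_algl k x) (esym (mulr_algr k x))).

Section AlgebraTheory.
Variable R : comPzRingType.

(* The underlying R-module of A, with k *: x = alg_map A k * x. *)
Definition alg_mod (A : algebra R) : lmodType R := pullback (alg_map A) A^o.

Definition algebra_morphism (A B : algebra R) (f : {rmorphism A -> B}) : Prop :=
  forall k : R, f (alg_map A k) = alg_map B k.

Section Dual.
Variable A : algebra R.

Definition dual : Type := {scalar (alg_mod A)}.

Definition dual_fun (f : dual) : A -> R := (f : {scalar (alg_mod A)}).
Coercion dual_fun : dual >-> Funclass.

Lemma dualP (f g : dual) : f =1 g -> f = g.
Proof.
case: f g => [f [[Df] [Zf]]] [g [[Dg] [Zg]]] /= /funext fg.
by rewrite /dual_fun /= in fg; case: _ / fg in Dg Zg *;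
   rewrite (Prop_irrelevance Df Dg) (Prop_irrelevance Zf Zg).
Qed.

HB.instance Definition _ := gen_eqMixin dual.
HB.instance Definition _ := gen_choiceMixin dual.

Definition dual_zero : dual := (\0 : {scalar (alg_mod A)}).
Definition dual_opp (f : dual) : dual :=
  (\- (f : {scalar (alg_mod A)}) : {scalar (alg_mod A)}).
Definition dual_add (f g : dual) : dual :=
  ((f : {scalar (alg_mod A)}) \+ (g : {scalar (alg_mod A)}) :
     {scalar (alg_mod A)}).

Fact dual_addA : associative dual_add.
Proof. by move=> f g h; apply: dualP => x; exact: addrA. Qed.

Fact dual_addC : commutative dual_add.
Proof. by move=> f g; apply: dualP => x; exact: addrC. Qed.

Fact dual_add0 : left_id dual_zero dual_add.
Proof. by move=> f; apply: dualP => x; exact: add0r. Qed.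

Fact dual_addN : left_inverse dual_zero dual_opp dual_add.
Proof. by move=> f; apply: dualP => x; exact: addNr. Qed.

HB.instance Definition _ :=
  GRing.isZmodule.Build dual dual_addA dual_addC dual_add0 dual_addN.

Definition dual_scale_fun (a : A) (f : dual) (b : alg_mod A) : R :=
  f ((b : A) * a).

Fact dual_scale_fun_is_linear a f : scalar (dual_scale_fun a f).
Proof.
move=> k x y; rewrite /dual_scale_fun mulrDl.
have -> : (k *: x : alg_mod A) = alg_map A k * x by [].
by rewrite -mulrA; exact: (linearP (f : {scalar (alg_mod A)})).
Qed.

HB.instance Definition _ a f :=
  GRing.isLinear.Build R (alg_mod A) R *%R (dual_scale_fun a f)
    (dual_scale_fun_is_linear a f).

(* (a . f) b = f (b a) *)
Definition dual_scale (a : A) (f : dual) : dual :=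
  (dual_scale_fun a f : {scalar (alg_mod A)}).

Fact dual_scaleA a b f : dual_scale a (dual_scale b f) = dual_scale (a * b) f.
Proof.
by apply: dualP => x; rewrite /dual_scale /dual_fun /= /dual_scale_fun -mulrA.
Qed.

Fact dual_scale1 : left_id 1 dual_scale.
Proof.
by move=> f; apply: dualP => x; rewrite {1}/dual_fun /= /dual_scale_fun mulr1.
Qed.

Fact dual_scaleDr : right_distributive dual_scale +%R.
Proof. by move=> a f g; apply: dualP => x. Qed.

Fact dual_scaleDl f : {morph dual_scale^~ f : a b / a + b}.
Proof.
move=> a b; apply: dualP => x; rewrite {1}/dual_fun /= /dual_scale_fun mulrDr.
exact: (raddfD (f : {scalar (alg_mod A)})).
Qed.

HB.instance Definition _ := GRing.Zmodule_isLmodule.Build A dual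
  dual_scaleA dual_scale1 dual_scaleDr dual_scaleDl.

Record frobenius := Frobenius {
  frob_fg : finitely_generated (alg_mod A);
  frob_proj : projective (alg_mod A);
  frob_iso : {linear A^o -> dual};
  frob_iso_bij : bijective frob_iso
}.

Definition trace (FA : frobenius) : dual := frob_iso FA 1.

End Dual.

Section Schur.
Variables (A B : algebra R) (FA : frobenius A) (FB : frobenius B).
Variables (phi : {rmorphism A -> B}) (phi_alg : algebra_morphism phi).

Definition trace_comp (a : alg_mod A) : R := trace FB (phi a).

Fact trace_comp_is_linear : scalar trace_comp.
Proof.
move=> k x y; rewrite /trace_comp [phi _]rmorphD.
have -> : phi (k *: x) = alg_map B k * phi x.
  by rewrite -phi_alg; exact: (rmorphM phi).
exact: (linearP (trace FB : {scalar (alg_mod B)})).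
Qed.

HB.instance Definition _ :=
  GRing.isLinear.Build R (alg_mod A) R *%R trace_comp trace_comp_is_linear.

Lemma schur_functional_subproof :
  exists! u : A, u *: trace FA = (trace_comp : {scalar (alg_mod A)}) :> dual A.
Proof.
have [g fK gK] := frob_iso_bij FA.
have E (u : A) : u *: trace FA = frob_iso FA (u : A^o).
  by rewrite /trace -linearZ; congr (frob_iso FA _); exact: mulr1.
exists (g (trace_comp : {scalar (alg_mod A)})); split; first by rewrite E gK.
by move=> u; rewrite E => <-; rewrite fK.
Qed.

Definition schur_element : B := phi (sval (cid schur_functional_subproof)).

Lemma schur_elementE (u : A) :
  (forall a : A, (u *: trace FA) a = trace FB (phi a)) -> schur_element = phi u.
Proof.
move=> uE; rewrite /schur_element; case: cid => v /= [_ vU].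
by congr (phi _); apply: vU; apply: dualP.
Qed.

End Schur.
End AlgebraTheory.

(* B as a right A-module via phi; phi is then right A-linear from A to it, and
   splits when it has a right A-linear section. *)
Definition splits_right (A B : pzRingType) (phi : {rmorphism A -> B}) : Prop :=
  exists sigma : {linear rpullback phi B^c^o -> A^c^o},
    forall b : B, phi (sigma b) = b.

(* Main.v *)
Require Import Defs.
From HB Require Import structures.
From mathcomp Require Import all_boot all_algebra.
From mathcomp Require Import boolp.
Set Implicit Arguments.
Unset Strict Implicit.
Unset Printing Implicit Defensive.
Import GRing.Theory.
Local Open Scope ring_scope.

(* Let K be the kernel of phi and write e for the trace of A or B.  The right
   trace form a |-> e(a -) is bijective along with the left one, which yields
   the Nakayama permutation nu, e(x b) = e(b nu(x)), and an element v of A with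
   e(v b) = e(phi b) for all b.  The elements annihilated by K on their right
   are exactly those of v A, so phi splits if and only if phi(v) has a right
   inverse.  It is then invertible, as v A = A v, and phi(v) is invertible if
   and only if nu(phi v) = s_phi is.
   If phi splits, let c be the value of a section at 1: then phi(c) = 1 and
   c K = 0.  Multiplication by c maps a right A-module N to the B-module
   {n | n K = 0} and is the identity on the latter, so that N |-> {n | n K = 0}
   preserves surjections; it is right adjoint to restriction along phi, which
   therefore preserves projectivity. *)

(** * Projectivity of the regular module and of retracts *)

Lemma projective_regular (S : pzRingType) : projective S^o.
Proof.
move=> N N' g f g_surj; have [n gn] := g_surj (f 1).
have lin_n : linear (fun a : S^o => (a : S) *: n).
  by move=> k x y; rewrite scalerDl -scalerA.
pose h : {linear S^o -> N} :=
  HB.pack (fun a : S^o => (a : S) *: n) (GRing.isLinear.Build _ _ _ _ _ lin_n).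
exists h => x; rewrite /= linearZ /= gn -linearZ; congr (f _).
exact: mulr1.
Qed.

Lemma projective_retract (S : pzRingType) (M M' : lmodType S)
    (s : {linear M' -> M}) (r : {linear M -> M'}) :
  cancel s r -> projective M -> projective M'.
Proof.
move=> sK projM N N' g f g_surj.
have [h hE] := projM N N' g (f \o r : {linear M -> N'}) g_surj.
by exists (h \o s : {linear M' -> N}) => x; rewrite /= hE /= sK.
Qed.

(** * The submodule annihilated by a kernel, as a module over the target ring *)

(* Used with S = A^c and T = B^c, whence the reversed sides. *)
Section Annihilated.
Variables (S T : pzRingType) (f : {rmorphism S -> T}).
Hypothesis f_surj : surjective f.
Variable N : lmodType S.

Definition ker_annihilated : {pred N} :=
  fun n => `[< forall k, f k = 0 -> k *: n = 0 >].

Lemma ker_annihilatedP n :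
  reflect (forall k, f k = 0 -> k *: n = 0) (n \in ker_annihilated).
Proof. exact: asboolP. Qed.

Fact ker_annihilated_submod : submod_closed ker_annihilated.
Proof.
split=> [|a x y /ker_annihilatedP xK /ker_annihilatedP yK];
  apply/ker_annihilatedP => k k0; first exact: scaler0.
by rewrite scalerDr scalerA yK // xK ?addr0 // rmorphM k0 mul0r.
Qed.

HB.instance Definition _ :=
  GRing.isSubmodClosed.Build S N ker_annihilated ker_annihilated_submod.

(* Depending on [f_surj] lets the instances below, which use it, be inferred. *)
Definition annihilated & surjective f : Type := {n : N | n \in ker_annihilated}.
Local Notation Q := (annihilated f_surj).

HB.instance Definition _ := SubChoice.on Q.
HB.instance Definition _ := [SubChoice_isSubZmodule of Q by <:].

Definition surj_lift (b : T) : S := sval (cid (f_surj b)).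

Lemma surj_liftK : cancel surj_lift f.
Proof. by move=> b; rewrite /surj_lift; case: cid. Qed.

Lemma val_annD (x y : Q) : val (x + y) = val x + val y.
Proof. exact: raddfD. Qed.

(** The difference [a - a'] lies in the kernel, which kills [x]; hence the action of [T] through
    chosen preimages is independent of the choice. *)
Lemma annihilated_scale (x : Q) (a a' : S) :
  f a = f a' -> a *: val x = a' *: val x.
Proof.
move=> faa'; apply/subr0_eq; rewrite -scalerBl.
by apply: (ker_annihilatedP _ (valP x)); rewrite rmorphB faa' subrr.
Qed.

Fact annihilated_scale_subproof (b : T) (x : Q) :
  surj_lift b *: val x \in ker_annihilated.
Proof. by apply: rpredZ; exact: valP. Qed.

Definition ann_scale (b : T) (x : Q) : Q :=
  Sub (surj_lift b *: val x) (annihilated_scale_subproof b x).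

Lemma val_ann_scale a x : val (ann_scale (f a) x) = a *: val x.
Proof. by rewrite SubK; apply: annihilated_scale; rewrite surj_liftK. Qed.

Fact ann_scaleA a b x : ann_scale a (ann_scale b x) = ann_scale (a * b) x.
Proof.
apply: val_inj; rewrite -(surj_liftK a) -(surj_liftK b) -rmorphM.
by rewrite !val_ann_scale scalerA.
Qed.

Fact ann_scale1 : left_id 1 ann_scale.
Proof.
by move=> x; apply: val_inj; rewrite -(rmorph1 f) val_ann_scale scale1r.
Qed.

Fact ann_scaleDr : right_distributive ann_scale +%R.
Proof.
move=> a x y; apply: val_inj.
by rewrite -(surj_liftK a) val_annD !val_ann_scale val_annD scalerDr.
Qed.

Fact ann_scaleDl x : {morph ann_scale^~ x : a b / a + b}.
Proof.
move=> a b; apply: val_inj; rewrite -(surj_liftK a) -(surj_liftK b) -rmorphD.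
by rewrite val_annD !val_ann_scale scalerDl.
Qed.

HB.instance Definition _ := GRing.Zmodule_isLmodule.Build T Q
  ann_scaleA ann_scale1 ann_scaleDr ann_scaleDl.

Lemma val_annZ (a : S) (x : Q) : val (f a *: x) = a *: val x.
Proof. exact: val_ann_scale. Qed.

End Annihilated.
Arguments ker_annihilated {S T} f N.

(** * Restriction of scalars, its right adjoint, and sections *)

Section Restriction.
Variables (S T : pzRingType) (f : {rmorphism S -> T}).
Hypothesis f_surj : surjective f.

Lemma pullbackZ (M : lmodType T) (a : S) (x : pullback f M) :
  a *: x = f a *: (x : M) :> M.
Proof. by []. Qed.

(** The kernel of [f] acts by zero on [pullback f M], hence on the image of [g]. Together with
    [annihilated_extend] this is the adjunction. *)
Lemma annihilated_corestrict (M : lmodType T) (N : lmodType S)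
    (g : {linear pullback f M -> N}) :
  exists h : {linear M -> annihilated N f_surj}, forall x, val (h x) = g x.
Proof.
have gP (x : M) : g x \in ker_annihilated f N.
  apply/ker_annihilatedP => k k0; rewrite -linearZ /= -[RHS](linear0 g).
  by congr (g _); rewrite pullbackZ k0 scale0r.
pose h0 (x : M) : annihilated N f_surj := Sub (g x) (gP x).
have h0_lin : linear h0.
  move=> b x y; apply: val_inj; rewrite -(surj_liftK f_surj b).
  rewrite val_annD val_annZ -linearZ -linearD; congr (g _).
pose h : {linear M -> annihilated N f_surj} :=
  HB.pack h0 (GRing.isLinear.Build _ _ _ _ _ h0_lin).
by exists h.
Qed.

Lemma annihilated_extend (M : lmodType T) (N : lmodType S)
    (h : {linear M -> annihilated N f_surj}) :
  exists g : {linear pullback f M -> N}, forall x, g x = val (h x).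
Proof.
pose g0 (x : pullback f M) : N := val (h x).
have g0_lin : linear g0.
  move=> a x y; rewrite /g0 -val_annZ -val_annD; congr (val _).
  by rewrite -linearP.
pose g : {linear pullback f M -> N} :=
  HB.pack g0 (GRing.isLinear.Build _ _ _ _ _ g0_lin).
by exists g.
Qed.

Lemma annihilated_map (N N' : lmodType S) (g : {linear N -> N'}) :
  exists h : {linear annihilated N f_surj -> annihilated N' f_surj},
    forall x, val (h x) = g (val x).
Proof.
have [v vE] := annihilated_extend (idfun : {linear annihilated N f_surj -> _}).
have [h hE] := annihilated_corestrict (g \o v : {linear _ -> N'}).
by exists h => x; rewrite hE /= vE.
Qed.

Lemma split_annihilator (s : {linear pullback f T^o -> S^o}) :
  cancel s f -> f (s 1) = 1 /\ forall k, f k = 0 -> k * (s 1 : S) = 0.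
Proof.
move=> sK; split=> [|k k0]; first exact: sK.
have -> : k * (s 1 : S) = s (k *: (1 : pullback f T^o)) by rewrite linearZ.
rewrite -[RHS](linear0 s); congr (s _); rewrite pullbackZ k0.
exact: mul0r.
Qed.

(** The section sends [b] to [a * c] for any preimage [a] of [b]; as the kernel kills [c], the
    choice of [a] is immaterial. *)
Lemma annihilator_split (c : S) :
  f c = 1 -> (forall k, f k = 0 -> k * c = 0) ->
  exists s : {linear pullback f T^o -> S^o}, cancel s f.
Proof.
move=> fc cK; pose s0 (b : pullback f T^o) : S^o := surj_lift f_surj b * c.
have s0E (b : T) a : f a = b -> s0 b = a * c.
  move=> fa; apply/subr0_eq; rewrite /s0 -mulrBl; apply: cK.
  by rewrite rmorphB surj_liftK fa subrr.
have s0_lin : linear s0.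
  move=> k x y.
  rewrite (s0E _ (k * surj_lift f_surj x + surj_lift f_surj y)).
    by rewrite mulrDl -mulrA.
  by rewrite rmorphD rmorphM !surj_liftK.
pose s : {linear pullback f T^o -> S^o} :=
  HB.pack s0 (GRing.isLinear.Build _ _ _ _ _ s0_lin).
exists s => b; rewrite /= /s0.
by rewrite rmorphM surj_liftK fc mulr1.
Qed.

Lemma projective_pullback (c : S) (P : lmodType T) :
  f c = 1 -> (forall k, f k = 0 -> k * c = 0) ->
  projective P -> projective (pullback f P).
Proof.
move=> fc cK projP N N' g t g_surj.
have [g' g'E] := annihilated_map g; have [t' t'E] := annihilated_corestrict t.
have [|h hE] := projP _ _ g' t'.
  move=> y; have [n gn] := g_surj (val y).
  (* The preimage [n] of [val y] need not be annihilated, but [c *: n] is, and [g] sends it to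
     [c *: val y], which is [val y] since [f c = 1]. *)
  have cnP : c *: n \in ker_annihilated f N.
    by apply/ker_annihilatedP => k k0; rewrite scalerA cK // scale0r.
  exists (Sub (c *: n) cnP : annihilated N f_surj); apply: val_inj.
  rewrite g'E SubK linearZ /= gn -[RHS]scale1r.
  by apply: annihilated_scale; rewrite fc rmorph1.
have [h' h'E] := annihilated_extend h.
by exists h' => x; rewrite h'E -g'E hE t'E.
Qed.

End Restriction.

(** * The trace form: dual bases, nondegeneracy on both sides, Nakayama permutation *)

Section TraceForm.
Variables (R : comPzRingType) (A : algebra R) (FA : frobenius A).
Local Notation tr := (trace FA).

Lemma dual_linear (g : dual A) : scalar (g : alg_mod A -> R).
Proof. exact: (linearP (g : {scalar (alg_mod A)})). Qed.

Lemma dual0 (g : dual A) : g 0 = 0.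
Proof. exact: (linear0 (g : {scalar (alg_mod A)})). Qed.

Lemma dual_sum (g : dual A) n (c : 'I_n -> R) (x : 'I_n -> A) :
  g (\sum_i alg_map A (c i) * x i) = \sum_i c i * g (x i).
Proof.
rewrite -[LHS]/((g : {scalar (alg_mod A)}) (\sum_i c i *: (x i : alg_mod A))).
by rewrite linear_sum; apply: eq_bigr => i _; rewrite linearZ.
Qed.

Lemma frob_isoE (u : A) : frob_iso FA u = u *: tr.
Proof.
by rewrite /trace -linearZ; congr (frob_iso FA _); exact/esym/mulr1.
Qed.

Lemma trace_form_injr (x y : A) :
  (forall b, tr (b * x) = tr (b * y)) -> x = y.
Proof.
move=> xy; apply: (bij_inj (frob_iso_bij FA)); apply: dualP => b.
by rewrite !frob_isoE; exact: xy.
Qed.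

Lemma trace_form_surjr (g : dual A) : exists u, forall b, g b = tr (b * u).
Proof.
have [h _ hK] := frob_iso_bij FA.
by exists (h g) => b; rewrite -{1}(hK g) frob_isoE.
Qed.

(** Projectivity splits the surjection from a free module given by generators [x i]; each coordinate
    of the splitting is a functional, so the trace form represents it by some [y i]. *)
Lemma trace_dual_basis : exists n (x y : 'I_n -> A),
  forall a, a = \sum_i alg_map A (tr (a * y i)) * x i.
Proof.
have [n [x xP]] := frob_fg FA.
pose p0 (c : 'rV[R]_n) : alg_mod A := \sum_i c 0 i *: x i.
have p0_lin : linear p0.
  move=> k c d; rewrite /p0 scaler_sumr -big_split; apply: eq_bigr => i _ /=.
  by rewrite !mxE scalerDl scalerA.
pose p : {linear 'rV[R]_n -> alg_mod A} :=
  HB.pack p0 (GRing.isLinear.Build _ _ _ _ _ p0_lin).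
have p_surj : surjective p.
  move=> a; have [c ->] := xP a; exists (\row_i c i).
  by apply: eq_bigr => i _; rewrite mxE.
have [h hE] := frob_proj FA (idfun : {linear alg_mod A -> alg_mod A}) p_surj.
have coord_lin i : scalar (fun a : alg_mod A => h a 0 i).
  by move=> k a b; rewrite linearP !mxE.
pose coord i : {scalar (alg_mod A)} := HB.pack (fun a : alg_mod A => h a 0 i)
  (GRing.isLinear.Build _ _ _ _ _ (coord_lin i)).
have [y yE] := fin_all_exists (fun i => trace_form_surjr (coord i)).
exists n, x, y => a; rewrite -[LHS]hE.
by apply: eq_bigr => i _; rewrite -yE.
Qed.

(** The dual basis recovers an element from its traces against the [b i] on its right. *)
Lemma trace_form_injl (x y : A) :
  (forall b, tr (x * b) = tr (y * b)) -> x = y.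
Proof.
move=> xy; have [n [a [b abE]]] := trace_dual_basis.
by rewrite (abE x) (abE y); apply: eq_bigr => i _; rewrite xy.
Qed.

Lemma trace_form_surjl (g : dual A) : exists v, forall b, g b = tr (v * b).
Proof.
have [n [x [y xyE]]] := trace_dual_basis.
(* The two families also form a dual basis with their roles exchanged; applying [g] to this
   expansion dictates the witness below. *)
have yxE b : b = \sum_i alg_map A (tr (x i * b)) * y i.
  apply: trace_form_injr => a; rewrite {1}(xyE a) mulr_suml mulr_sumr.
  under eq_bigr => i _ do rewrite -mulrA.
  under [X in _ = tr X]eq_bigr => i _ do rewrite mulrA -alg_central -mulrA.
  by rewrite !dual_sum; apply: eq_bigr => i _; rewrite mulrC.
exists (\sum_i alg_map A (g (y i)) * x i) => b.
rewrite {1}(yxE b) dual_sum mulr_suml.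
under [X in _ = tr X]eq_bigr => i _ do rewrite -mulrA.
by rewrite dual_sum; apply: eq_bigr => i _; rewrite mulrC.
Qed.

Definition nakayama (x y : A) := forall b, tr (x * b) = tr (b * y).

Lemma nakayama_ex x : exists y, nakayama x y.
Proof.
have lin_x : scalar (fun b : alg_mod A => tr (x * b)).
  move=> k a b; rewrite mulrDr.
  have -> : x * (k *: a : alg_mod A) = k *: (x * a : alg_mod A).
    by rewrite [LHS]mulrA -alg_central -mulrA.
  exact: dual_linear.
pose g : {scalar (alg_mod A)} := HB.pack (fun b : alg_mod A => tr (x * b))
  (GRing.isLinear.Build _ _ _ _ _ lin_x).
exact: (trace_form_surjr g).
Qed.

Lemma nakayama_surj y : exists x, nakayama x y.
Proof.
have [x xE] := trace_form_surjl (y *: tr).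
by exists x => b; rewrite -xE.
Qed.

(** The relation is the graph of a multiplicative bijection fixing 1, so inverses correspond. *)
Lemma nakayama_invertible x y :
  nakayama x y -> invertible x <-> invertible y.
Proof.
have nu1 : nakayama 1 1 by move=> b; rewrite mul1r mulr1.
have nuM a b a' b' : nakayama a a' -> nakayama b b' ->
    nakayama (a * b) (a' * b').
  by move=> aE bE c; rewrite -mulrA aE -mulrA bE mulrA.
have nu_inj a a' b : nakayama a b -> nakayama a' b -> a = a'.
  by move=> aE a'E; apply: trace_form_injl => c; rewrite aE a'E.
have nu_fun a b b' : nakayama a b -> nakayama a b' -> b = b'.
  by move=> bE b'E; apply: trace_form_injr => c; rewrite -bE b'E.
move=> xy; split=> [[z [xz zx]]|[w [yw wy]]].
  have [w zw] := nakayama_ex z; exists w.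
  have := nuM _ _ _ _ zw xy; have := nuM _ _ _ _ xy zw.
  by rewrite xz zx => yw1 wy1; split; apply: nu_fun nu1.
have [z zw] := nakayama_surj w; exists z.
have := nuM _ _ _ _ zw xy; have := nuM _ _ _ _ xy zw.
by rewrite yw wy => xz1 zx1; split; apply: nu_inj nu1.
Qed.

End TraceForm.

(** * The right-handed analogue of the Schur element *)

Section RightSchur.
Variables (R : comPzRingType) (A B : algebra R).
Variables (FA : frobenius A) (FB : frobenius B).
Variables (phi : {rmorphism A -> B}) (phi_alg : algebra_morphism phi).
Hypothesis phi_surj : surjective phi.

Definition right_schur (v : A) := forall b, trace FB (phi b) = trace FA (v * b).

Lemma right_schur_ex : exists v, right_schur v.
Proof.
exact: (trace_form_surjl FA (trace_comp FB phi : {scalar (alg_mod A)})).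
Qed.

Variable v : A.
Hypothesis vE : right_schur v.

(** For [u] defining the Schur element, the traces of [phi (v * a)] and [phi (a * u)] both equal
    that of [v * a * u]. *)
Lemma schur_nakayama : nakayama FB (phi v) (schur_element FA FB phi_alg).
Proof.
have [u uE] :=
  trace_form_surjr FA (trace_comp FB phi : {scalar (alg_mod A)}).
rewrite (@schur_elementE _ _ _ FA FB _ phi_alg u) => [b|a]; last exact/esym/uE.
have {}uE a : trace FB (phi a) = trace FA (a * u) by exact: uE.
have [a <-] := phi_surj b; rewrite -!rmorphM.
by rewrite uE -mulrA -vE.
Qed.

Lemma right_schur_ker k : phi k = 0 -> v * k = 0.
Proof.
move=> k0; apply: (@trace_form_injl _ _ FA) => b.
by rewrite -mulrA -vE rmorphM k0 !mul0r !dual0.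
Qed.

(** The functional [tr (c * -)] vanishes on the kernel, so it descends to [B], where some [d]
    represents it; any lift of [d] serves as [a]. *)
Lemma right_schur_annihilator c :
  (forall k, phi k = 0 -> c * k = 0) -> exists a, c = v * a.
Proof.
move=> cK.
have cE (b : A) : trace FA (c * b) = trace FA (c * surj_lift phi_surj (phi b)).
  congr (trace FA _); apply/subr0_eq; rewrite -mulrBr cK //.
  by rewrite rmorphB surj_liftK subrr.
pose g0 (b : alg_mod B) : R := trace FA (c * surj_lift phi_surj b).
have g0_lin : scalar g0.
  move=> k x y; have [a <-] := phi_surj x; have [b <-] := phi_surj y.
  have -> : k *: (phi a : alg_mod B) + phi b = phi (alg_map A k * a + b).
    by rewrite rmorphD rmorphM phi_alg.
  rewrite /g0 -!cE mulrDr mulrA -alg_central -mulrA.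
  exact: dual_linear.
pose g : {scalar (alg_mod B)} :=
  HB.pack g0 (GRing.isLinear.Build _ _ _ _ _ g0_lin).
have [d dE] := trace_form_surjl FB g.
have [a ad] := phi_surj d; exists a.
apply: (@trace_form_injl _ _ FA) => b.
by rewrite cE -mulrA -vE rmorphM ad -dE.
Qed.

(** Move [phi a] across the trace of [B], lift the result to [w], and move [w] back across the trace
    of [A]. *)
Lemma right_schur_normal a : exists a', v * a = a' * v.
Proof.
have [d dE] := nakayama_ex FB (phi a); have [w wd] := phi_surj d.
have [a' a'E] := nakayama_surj FA w; exists a'.
apply: (@trace_form_injl _ _ FA) => b.
by rewrite -!mulrA a'E -vE rmorphM dE -wd -rmorphM vE mulrA.
Qed.

Lemma right_schur_invertible :
  invertible (phi v) <->
  exists2 c, phi c = 1 & forall k, phi k = 0 -> c * k = 0.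
Proof.
split=> [[d [vd _]]|[c c1 /right_schur_annihilator[a cE]]].
  have [a ad] := phi_surj d; exists (v * a) => [|k k0].
    by rewrite rmorphM ad.
  by rewrite -mulrA right_schur_ker // rmorphM k0 mulr0.
(* Rewriting [v * a] as [a' * v] supplies a left inverse besides the right one. *)
have [a' a'E] := right_schur_normal a.
have va : phi v * phi a = 1 by rewrite -rmorphM -cE.
have a'v : phi a' * phi v = 1 by rewrite -rmorphM -a'E -cE.
exists (phi a); split=> //.
by rewrite -[phi a]mul1r -{1}a'v -(mulrA (phi a')) va mulr1.
Qed.

End RightSchur.

Theorem proposition4p12 (R : comPzRingType) (A B : algebra R)
    (FA : frobenius A) (FB : frobenius B)
    (phi : {rmorphism A -> B}) (phi_alg : algebra_morphism phi)
    (phi_surj : surjective phi) :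
  [<-> invertible (schur_element FA FB phi_alg);
       splits_right phi;
       projective (rpullback phi B^c^o);
       forall P : rmodType B, projective P -> projective (rpullback phi P)].
Proof.
have [v vE] := right_schur_ex FA FB phi_alg.
have s_inv := nakayama_invertible (schur_nakayama phi_alg phi_surj vE).
have v_inv := right_schur_invertible phi_alg phi_surj vE.
pose phi_lin0 : A^c^o -> rpullback phi B^c^o := phi.
have phi_lin_subproof : linear phi_lin0.
  move=> a x y; rewrite /phi_lin0 [LHS]rmorphD; congr (_ + _).
  exact: (rmorphM phi).
pose phi_lin : {linear A^c^o -> rpullback phi B^c^o} :=
  HB.pack phi_lin0 (GRing.isLinear.Build _ _ _ _ _ phi_lin_subproof).
pose phi_c : {rmorphism A^c -> B^c} := converse_hom phi.
have phi_csurj : surjective phi_c by exact: phi_surj.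
(* The section lifts the identity of [B] along [phi]. *)
have proj_split : projective (rpullback phi B^c^o) -> splits_right phi.
  move=> /(_ _ _ phi_lin (idfun : {linear _ -> _}) phi_surj)[s sE].
  by exists s.
have split_ann : splits_right phi ->
    exists2 c, phi c = 1 & forall k, phi k = 0 -> c * k = 0.
  case=> s sK; have [] := @split_annihilator _ _ phi_c s sK.
  by exists (s 1).
tfae.
- move=> /s_inv/v_inv[c c1 cK].
  by have [s sK] := annihilator_split phi_csurj c1 cK; exists s.
- move=> [s sK].
  exact: (@projective_retract _ _ _ s phi_lin sK (@projective_regular _)).
- move=> /proj_split/split_ann[c c1 cK] P.
  exact: (projective_pullback phi_csurj c1 cK).
- move=> /(_ _ (@projective_regular _))/proj_split/split_ann ann.
  exact/s_inv/v_inv.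
Qed.
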